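(* Let $X$ be a set with $|X|\geq 2$ and let $\mathcal{B} \subset \mathrm{Br}(X)$ be a Hall set. For every $a < b \in \mathcal{B}$, $$\| [a, b] \|_{\mathcal{B}} \leq \lfloor e\,(|b|-1)! \rfloor,$$ where $e$ is Euler's number.
   Context: The base field is $\mathbb{K}=\mathbb{R}$ or $\mathbb{C}$; $X$ is a set (possibly infinite) with at least two elements. $\mathrm{Br}(X)$ is the free magma over $X$: the set of formal binary brackets (rooted planar binary trees with leaves labelled by elements of $X$), with product $(t_1,t_2)$. For $t\in \mathrm{Br}(X)$, $|t|$ is its number of leaves; if $t\notin X$, $t$ is written uniquely as $t=(\lambda(t),\mu(t))$. $\mathcal{L}(X)$ is the free Lie algebra over $X$ and $\mathrm{ev}:\mathrm{Br}(X)\to\mathcal{L}(X)$ is the canonical evaluation ($\mathrm{ev}(x)=x$ for $x\in X$, $\mathrm{ev}((t_1,t_2))=[\mathrm{ev}(t_1),\mathrm{ev}(t_2)]$). For $a,b\in\mathrm{Br}(X)$, $[a,b]$ denotes $[\mathrm{ev}(a),\mathrm{ev}(b)]\in\mathcal{L}(X)$. A Hall set is a subset $\mathcal{B}\subset\mathrm{Br}(X)$ endowed with a total order $<$ such that: (i) $X\subset\mathcal{B}$; (ii) for all $b_1,b_2\in\mathrm{Br}(X)$, $(b_1,b_2)\in\mathcal{B}$ iff $b_1,b_2\in\mathcal{B}$, $b_1<b_2$ and either $b_2\in X$ or $\lambda(b_2)\leq b_1$; (iii) for all $b_1,b_2\in\mathcal{B}$ with $(b_1,b_2)\in\mathcal{B}$,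 $b_1<(b_1,b_2)$. By a theorem of Viennot, $\mathrm{ev}$ is injective on $\mathcal{B}$ and $\mathrm{ev}(\mathcal{B})$ is a basis of $\mathcal{L}(X)$. For $u=\sum_{c\in\mathcal{B}}\alpha_c\,\mathrm{ev}(c)\in\mathcal{L}(X)$ (finite sum), $\|u\|_{\mathcal{B}}:=\sum_{c}|\alpha_c|$. *)

(* Defs.v *)
From HB Require Import structures.
From mathcomp Require Import all_boot all_order all_algebra.
From mathcomp Require Import boolp classical_sets functions cardinality fsbigop.
From mathcomp Require Import reals sequences exp.
From mathcomp Require Import complex.

Set Implicit Arguments.
Unset Strict Implicit.
Unset Printing Implicit Defensive.

Import Order.TTheory GRing.Theory Num.Theory.
Local Open Scope classical_set_scope.
Local Open Scope ring_scope.

Variant scalars := RealScalars | ComplexScalars.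

Definition scalar_field (R : realType) (k : scalars) : numFieldType :=
  match k with
  | RealScalars => R
  | ComplexScalars => R[i]%C
  end.

Inductive br (X : Type) : Type :=
| Leaf of X
| Node of br X & br X.

(* Classical instances: no structure is required of the set X. *)
HB.instance Definition _ (X : Type) := gen_eqMixin (br X).
HB.instance Definition _ (X : Type) := gen_choiceMixin (br X).

Fixpoint br_size (X : Type) (t : br X) : nat :=
  match t with
  | Leaf _ => 1
  | Node t1 t2 => (br_size t1 + br_size t2)%N
  end.

HB.mixin Record Lmodule_isLie (K : pzRingType) (L : Type)
    of GRing.Lmodule K L := {
  lie : L -> L -> L;
  lie_linearl : forall y : L, linear (fun x : L => lie x y);
  lie_linearr : forall x : L, linear (lie x);
  liexx : forall x : L, lie x x = 0;
  lie_jacobi : forall x y z : L,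
    lie x (lie y z) + lie y (lie z x) + lie z (lie x y) = 0
}.

#[short(type="lieAlgType")]
HB.structure Definition LieAlgebra (K : pzRingType) :=
  { L of GRing.Lmodule K L & Lmodule_isLie K L }.

Definition lie_morphism (K : pzRingType) (L M : lieAlgType K) (g : L -> M) :=
  linear g /\ forall u v : L, g (lie u v) = lie (g u) (g v).

Definition is_free_lie_algebra (K : pzRingType) (X : Type)
    (L : lieAlgType K) (i : X -> L) : Prop :=
  forall (M : lieAlgType K) (f : X -> M),
    exists! g : L -> M, lie_morphism g /\ forall x : X, g (i x) = f x.

Fixpoint ev (K : pzRingType) (X : Type) (L : lieAlgType K) (i : X -> L)
    (t : br X) : L :=
  match t with
  | Leaf x => i x
  | Node t1 t2 => lie (ev i t1) (ev i t2)
  end.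

(* [lt] is the strict order; only its restriction to [B] matters. *)
Record hall_set (X : Type) (B : set (br X)) (lt : rel (br X)) : Prop := {
  hall_irr : forall a, B a -> ~~ lt a a;
  hall_trans : forall a b c, B a -> B b -> B c -> lt a b -> lt b c -> lt a c;
  hall_total : forall a b, B a -> B b -> [\/ lt a b, a = b | lt b a];
  hall_leaf : forall x : X, B (Leaf x);
  hall_node : forall b1 b2 : br X,
    B (Node b1 b2) <->
    [/\ B b1, B b2, lt b1 b2
      & match b2 with
        | Leaf _ => True
        | Node l _ => l = b1 \/ lt l b1
        end];
  hall_lt : forall b1 b2 : br X,
    B b1 -> B b2 -> B (Node b1 b2) -> lt b1 (Node b1 b2)
}.

Definition hall_expansion (K : numFieldType) (X : Type) (L : lieAlgType K)
    (i : X -> L) (B : set (br X)) (u : L) (alpha : br X -> K) : Prop :=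
  [/\ finite_set [set c | alpha c != 0],
      (forall c, ~ B c -> alpha c = 0)
    & u = \sum_(c \in B) alpha c *: ev i c].

(* When [i] is free and [B] is a Hall set, Viennot's theorem says that every
   [u] has exactly one expansion, so the default value is never taken. *)
Definition hall_coord (K : numFieldType) (X : Type) (L : lieAlgType K)
    (i : X -> L) (B : set (br X)) (u : L) : br X -> K :=
  xget (fun=> 0) [set alpha | hall_expansion i B u alpha].

(* The value is a nonnegative real element of K. *)
Definition hall_norm (K : numFieldType) (X : Type) (L : lieAlgType K)
    (i : X -> L) (B : set (br X)) (u : L) : K :=
  \sum_(c \in B) `|hall_coord i B u c|.

(* Main.v *)
(* Linear independence of the Hall elements follows by Lazard elimination, and
   makes the norm of a signed sum of n of them at most n. Given operators f(t)
   for the letters t of the alphabet left after eliminating the smallest letter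
   h, let h act as d/dz on V-valued functions of z and t as multiplication by the
   sum over k of z^k/k! f(h,(h,...,(h,t))): brackets then act at z = 0 as they do
   after the elimination, and h kills constants, so a linear relation survives
   successive eliminations until it has a single term.

   For the bound: if a tree over an alphabet of letters has n + 1 leaves, then
   eliminating its smallest letter h, which acts as a derivation on its sibling,
   leaves at most n trees with n leaves, so the norm is at most n!. For a < b,
   the bracket [a,b] is the sum over the leaves y of b (in the alphabet above a)
   of b with y replaced by the letter g = (a,y). If g is the smallest letter, it
   acts in turn as a derivation on its sibling, itself a Hall tree; otherwise
   some subtree (h,y') made of letters merges into one letter, which saves a
   factor n, except at one leaf. The sizes of the siblings of the leaves are at
   worst those of a comb, namely 1, 1, 2, ..., m - 1 for m leaves, so the number
   of terms satisfies the recursion defining [weight], which solves to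
   sum_k n!/k! <= e n! with n = |b| - 1. *)

Require Import Defs.
From HB Require Import structures.
From mathcomp Require Import all_boot all_order all_algebra.
From mathcomp Require Import boolp classical_sets functions cardinality fsbigop.
From mathcomp Require Import reals sequences exp zify.

Set Implicit Arguments.
Unset Strict Implicit.
Unset Printing Implicit Defensive.

Import Order.TTheory GRing.Theory Num.Theory.
Local Open Scope ring_scope.

(** * The Lie algebra of endomorphisms *)

Section EndomorphismLieAlgebra.
Variables (K : comPzRingType) (V : lmodType K).

Definition linear_fun : {pred V -> V} := fun f => `[< linear f >].

Lemma linear_funP f : reflect (linear f) (f \in linear_fun).
Proof. exact: asboolP. Qed.

Fact linear_fun_submod : submod_closed linear_fun.
Proof.
split=> [|a f g /linear_funP lf /linear_funP lg]; apply/linear_funP => b u v.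
  by rewrite /= scaler0 addr0.
rewrite !fctE /= lf lg !scalerDr !scalerA mulrC -!addrA; congr (_ + _).
by rewrite addrCA.
Qed.

HB.instance Definition _ :=
  GRing.isSubmodClosed.Build K (V -> V) linear_fun linear_fun_submod.

(** With the commutator as bracket, this is the target of the universal property of the free Lie
    algebra in the proof of independence. *)
Record endo := Endo { endo_fun :> V -> V; endo_linear : endo_fun \in linear_fun }.

HB.instance Definition _ := [isSub for endo_fun].
HB.instance Definition _ := [Choice of endo by <:].
HB.instance Definition _ := [SubChoice_isSubLmodule of endo by <:].

Lemma endoP (f g : endo) : f =1 g -> f = g.
Proof. by move=> fg; apply/val_inj/funext. Qed.

Lemma endoL (f : endo) : linear f.
Proof. exact/linear_funP/endo_linear. Qed.

Lemma endoD (f g : endo) v : (f + g) v = f v + g v.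
Proof. by []. Qed.
Lemma endo0 v : (0 : endo) v = 0.
Proof. by []. Qed.

Definition commutator (f g : V -> V) (v : V) : V := f (g v) - g (f v).

Lemma commutator_linear f g : linear f -> linear g -> linear (commutator f g).
Proof.
move=> lf lg a u v; rewrite /commutator !(lf, lg) scalerBr opprD !addrA.
by congr (_ + _); rewrite addrAC.
Qed.

Definition endo_lie (f g : endo) : endo :=
  Endo (introT (linear_funP _) (commutator_linear (endoL f) (endoL g))).

Lemma endo_sub (f : endo) u v : f (u - v) = f u - f v.
Proof. by rewrite addrC -scaleN1r endoL scaleN1r addrC. Qed.

Fact endo_lie_linearl (g : endo) : linear (endo_lie^~ g).
Proof.
move=> a f f'; apply: endoP => v.
change (a *: f (g v) + f' (g v) - g (a *: f v + f' v)
  = a *: (f (g v) - g (f v)) + (f' (g v) - g (f' v))).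
by rewrite endoL scalerBr opprD addrACA.
Qed.

Fact endo_lie_linearr (f : endo) : linear (endo_lie f).
Proof.
move=> a g g'; apply: endoP => v.
change (f (a *: g v + g' v) - (a *: g (f v) + g' (f v))
  = a *: (f (g v) - g (f v)) + (f (g' v) - g' (f v))).
by rewrite endoL scalerBr opprD addrACA.
Qed.

Fact endo_liexx f : endo_lie f f = 0.
Proof. by apply: endoP => v; rewrite endo0 /= /commutator subrr. Qed.

Fact endo_jacobi f g h :
  endo_lie f (endo_lie g h) + endo_lie g (endo_lie h f)
    + endo_lie h (endo_lie f g) = 0.
Proof.
apply: endoP => v; rewrite !endoD endo0 /= /commutator !endo_sub !opprB.
have telescope (a b c : V) : a - b + (b - c) = a - c by rewrite addrA subrK.
have cancel6 (a b c d p q : V) :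
    a - b + (c - d) + (d - p + (b - q)) + (q - c + (p - a)) = 0.
  by rewrite [d - p + _]addrC (addrACA (a - b)) !telescope addrACA !telescope subrr.
exact: cancel6.
Qed.

HB.instance Definition _ := Lmodule_isLie.Build K endo
  endo_lie_linearl endo_lie_linearr endo_liexx endo_jacobi.

End EndomorphismLieAlgebra.

(** * Linear independence of Hall elements *)

Section Independence.
Variables (X : Type) (B : set (br X)) (lt : rel (br X)).
Hypothesis HB : hall_set B lt.

Lemma hall_irrF a : B a -> lt a a -> False.
Proof. by move/(hall_irr HB)/negP. Qed.

Lemma hall_asym a b : B a -> B b -> lt a b -> lt b a -> False.
Proof.
move=> Ba Bb ab ba.
exact: hall_irrF Ba (hall_trans HB Ba Bb Ba ab ba).
Qed.

Lemma hall_min (s : seq (br X)) : s != [::] -> (forall x, x \in s -> B x) ->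
  exists2 h, h \in s & forall x, x \in s -> h = x \/ lt h x.
Proof.
elim: s => // y s IHs _ Bs; have By := Bs y (mem_head _ _).
have [->|sN0] := eqVneq s [::].
  by exists y; rewrite ?mem_head // => x; rewrite inE => /eqP ->; left.
have {}Bs x : x \in s -> B x by move=> xs; apply: Bs; rewrite inE xs orbT.
have [h hs hmin] := IHs sN0 Bs; have Bh := Bs h hs.
case: (hall_total HB By Bh) => [yh|yh|hy].
- exists y; rewrite ?mem_head // => x; rewrite inE => /orP[/eqP->|xs]; first by left.
  right; case: (hmin x xs) => [<- //|hx]; exact: (hall_trans HB By Bh (Bs x xs)).
- exists y; rewrite ?mem_head // => x; rewrite inE => /orP[/eqP->|xs]; first by left.
  by rewrite yh; apply: hmin.
- exists h; first by rewrite inE hs orbT.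
  by move=> x; rewrite inE => /orP[/eqP->|/hmin//]; right.
Qed.

Section Operators.
Variables (K : comNzRingType) (alpha : br X -> K).

(* Lazard elimination: the trees outside [R] have been eliminated, so the trees
   whose left factor lies outside [R] are the letters of the new alphabet, and
   [f] says how the letters act on [V]. *)
Fixpoint act (V : lmodType K) (f : br X -> V -> V) (R : seq (br X)) (t : br X)
    : V -> V :=
  match t with
  | Leaf _ => f t
  | Node l r => if l \in R then commutator (act f R l) (act f R r) else f t
  end.

Definition letter (R : seq (br X)) (t : br X) : bool :=
  if t is Node l _ then l \notin R else true.

Lemma act_letter (V : lmodType K) (f : br X -> V -> V) R t :
  letter R t -> act f R t = f t.
Proof. by case: t => //= l r /negbTE ->. Qed.

(** All modules [V] are quantified over because one elimination step replaces [V] by the sequences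
    [nat -> V]. *)
Definition vanishing (R : seq (br X)) := forall (V : lmodType K) (f : br X -> V -> V),
  (forall t, linear (f t)) -> forall v, \sum_(t <- R) alpha t *: act f R t v = 0.

Section Elimination.
Variables (V : lmodType K) (f : br X -> V -> V) (h : br X).

Definition shift (v : nat -> V) : nat -> V := fun n => v n.+1.

(* The Taylor coefficients at z = 0 of exp(z ad h) f(t), acting on the Taylor
   coefficients of a V-valued function of z, while [shift] stands for d/dz. *)
Fixpoint taylor (n : nat) (t : br X) (v : nat -> V) : V :=
  match n with
  | 0 => f t (v 0)
  | n'.+1 => taylor n' (Node h t) v + taylor n' t (shift v)
  end.

Definition extend (t : br X) (v : nat -> V) : nat -> V :=
  if t == h then shift v else fun n => taylor n t v.

Hypothesis lin_f : forall t, linear (f t).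

Lemma extend_linear t : linear (extend t).
Proof.
rewrite /extend => a u v; case: eqP => // _; apply: funext => n.
rewrite !fctE.
elim: n t u v => [|n IHn] t u v /=; first exact: lin_f.
have -> : shift (a *: u + v) = a *: shift u + shift v by [].
by rewrite !IHn scalerDr addrACA.
Qed.

Variable R : seq (br X).
Hypothesis BR : forall t, t \in R -> B t.
Hypothesis R_right : forall l r, Node l r \in R -> l \in R -> r \in R.
Hypothesis hR : h \in R.
Hypothesis h_min : forall t, t \in R -> h = t \/ lt h t.

Let R' := rem h R.
Hypothesis uniqR : uniq R.

(** A Hall tree (l,h) with [l] in [R] would need l < h, against minimality. *)
Lemma rem_right l r : Node l r \in R' -> l \in R' -> r \in R'.
Proof.
rewrite !(mem_rem_uniq _ uniqR) !inE => /andP[_ lrR] /andP[lh lR].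
have rR := R_right lrR lR; rewrite rR andbT; apply/eqP => rh.
have [_ _ + _] := (hall_node HB l r).1 (BR lrR).
case: (h_min lR) => [hl|hl]; first by rewrite -hl eqxx in lh.
by rewrite rh => /(hall_asym (BR hR) (BR lR) hl).
Qed.

Lemma left_factor_lt l r : B (Node l r) -> lt l (Node l r).
Proof.
by move=> Blr; have [Bl Br _ _] := (hall_node HB l r).1 Blr; apply: (hall_lt HB).
Qed.

Lemma min_letter : letter R h.
Proof.
rewrite /letter; case E: h => [//|l r]; apply/negP => lR.
have Bh := BR hR; rewrite E in Bh; have lth := left_factor_lt Bh; rewrite -E in lth Bh.
case: (h_min lR) => [hl|hl]; last exact: (hall_asym (BR hR) (BR lR) hl lth).
by rewrite hl in lth; apply: hall_irrF (BR lR) lth.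
Qed.

(* The trees (h,(h,...,(h,y))) are the letters created by eliminating h. *)
Lemma act_extend_letter t : t \in R -> t != h -> letter R' t ->
  act extend R t = extend t.
Proof.
elim: t => [//|l _ r IHr] /= tR tNh.
rewrite (mem_rem_uniq _ uniqR) !inE negb_and negbK.
case: ifP => [lR|//]; rewrite orbF => /eqP lh; subst l.
have rR := R_right tR hR.
have [Bh Br hr lr] := (hall_node HB h r).1 (BR tR).
have rNh : r != h by apply/eqP => rh; rewrite rh in hr; apply: hall_irrF hr.
rewrite IHr // => [|{IHr}]; last first.
  case: r lr {tR tNh rNh Br hr} rR => //= l r + lrR.
  rewrite (mem_rem_uniq _ uniqR) !inE.
  have [-> //|lNh /=] := eqVneq l h.
  case=> [lh|lh]; [by rewrite lh eqxx in lNh|apply/negP => {}lR].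
  case: (h_min lR) => [hl|hl]; first by rewrite hl eqxx in lNh.
  exact: (hall_asym (BR hR) (BR lR) hl lh).
rewrite act_letter ?min_letter //; apply: funext => v.
rewrite /extend eqxx (negbTE rNh) (negbTE tNh) /commutator.
apply: funext => n; rewrite !fctE /= {1}/shift /=.
by rewrite addrK.
Qed.

(** At z = 0 only the constant term of a letter is left; the trees that are not letters are
    commutators of trees other than h, and evaluation at 0 respects these. *)
Lemma act_extend0 t v : t \in R -> t != h ->
  act extend R t v 0 = act f R' t (v 0).
Proof.
move=> tR tNh; have [tL|] := boolP (letter R' t).
  by rewrite act_extend_letter // act_letter // /extend (negbTE tNh).
elim: t v tR tNh => [//|l IHl r IHr] v tR tNh /=; rewrite negbK => lR'.
rewrite lR'; have := lR'; rewrite (mem_rem_uniq _ uniqR) !inE => /andP[lNh lR].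
have tR' : Node l r \in R' by rewrite (mem_rem_uniq _ uniqR) !inE tNh.
have := rem_right tR' lR'; rewrite (mem_rem_uniq _ uniqR) !inE => /andP[rNh rR].
have act0 s : s \in R -> s != h ->
    (forall v, s \in R -> s != h -> ~~ letter R' s ->
      act extend R s v 0 = act f R' s (v 0)) ->
    forall v, act extend R s v 0 = act f R' s (v 0).
  move=> sR sNh IH w; have [sL|sL] := boolP (letter R' s); last exact: IH.
  by rewrite act_extend_letter // act_letter // /extend (negbTE sNh).
rewrite lR /commutator !fctE.
by rewrite (act0 l lR lNh IHl) !(act0 r rR rNh IHr) (act0 l lR lNh IHl).
Qed.

End Elimination.

Lemma sum_rem (M : nmodType) (F : br X -> M) (R : seq (br X)) h : h \in R ->
  \sum_(t <- R) F t = F h + \sum_(t <- rem h R) F t.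
Proof. by move=> hR; rewrite (perm_big _ (perm_to_rem hR)) /= big_cons. Qed.

Lemma vanishing_eq0 R : uniq R -> (forall t, t \in R -> B t) ->
  (forall l r, Node l r \in R -> l \in R -> r \in R) ->
  vanishing R -> forall t, t \in R -> alpha t = 0.
Proof.
elim: {R}(size R) {-2}R (erefl (size R)) => [|n IHn] R szR uR BR rR van.
  by move=> t; rewrite (size0nil szR).
have RN0 : R != [::] by case: R szR {uR BR rR van}.
have [h hR h_min] := hall_min RN0 BR.
have alpha0 t : t \in rem h R -> alpha t = 0.
  apply: IHn; first by rewrite size_rem // szR.
  - exact: rem_uniq.
  - by move=> s /mem_rem /BR.
  - exact: (rem_right BR rR hR h_min uR).
  (* The sequence [v'] is the constant function v, which [shift] kills: the term of h drops out and
     the relation passes to [rem h R]. *)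
  move=> V f lin_f v; pose v' : nat -> V := fun n => if n is 0 then v else 0.
  have /(congr1 (fun w => w 0)) := van _ _ (extend_linear h lin_f) v'.
  rewrite (sum_rem _ hR).
  rewrite act_letter ?(min_letter BR hR h_min) //.
  have -> : extend f h h v' = 0 by rewrite /extend eqxx; apply: funext.
  rewrite scaler0 add0r fct_sumE => sum0; rewrite -[RHS]sum0.
  apply: eq_big_seq => s sR; rewrite scalrfctE.
  have := sR; rewrite (mem_rem_uniq _ uR) !inE => /andP[sNh {}sR].
  by rewrite (act_extend0 _ BR rR hR h_min uR).
move=> t tR; have [->|tNh] := eqVneq t h; last first.
  by apply: alpha0; rewrite (mem_rem_uniq _ uR) !inE tNh.
(* Only the term of h is left; letting every letter act as the identity of K isolates its
   coefficient. *)
have := van K^o (fun=> id) (fun _ _ _ _ => erefl) 1.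
rewrite (sum_rem _ hR) act_letter ?(min_letter BR hR h_min) //.
rewrite big1_seq => [|s /andP[_ sR]]; last by rewrite (alpha0 s sR) scale0r.
by rewrite addr0 /GRing.scale /= mulr1.
Qed.

End Operators.

(** * Transfer to the free Lie algebra *)

Fixpoint subtrees (t : br X) : seq (br X) :=
  t :: if t is Node l r then subtrees l ++ subtrees r else [::].

Lemma subtrees_refl t : t \in subtrees t.
Proof. by case: t => *; rewrite mem_head. Qed.

Lemma subtrees_node t l r : Node l r \in subtrees t ->
  l \in subtrees t /\ r \in subtrees t.
Proof.
elim: t => [x|a IHa b IHb] /=; first by rewrite inE => /eqP.
rewrite inE mem_cat; case/or3P=> [/eqP[-> ->]|/IHa[la ra]|/IHb[lb rb]].
- by rewrite !inE !mem_cat !subtrees_refl !orbT.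
- by rewrite !inE !mem_cat la ra !orbT.
- by rewrite !inE !mem_cat lb rb !orbT.
Qed.

Lemma hall_subtrees t s : B t -> s \in subtrees t -> B s.
Proof.
elim: t => [x|a IHa b IHb] Bt /=; rewrite inE; first by move/eqP->.
have [Ba Bb _ _] := (hall_node HB a b).1 Bt.
by rewrite mem_cat => /or3P[/eqP->|/IHa|/IHb] //; apply.
Qed.

Variables (K : comNzRingType) (L : lieAlgType K) (i : X -> L).
Hypothesis free : is_free_lie_algebra i.

Lemma hall_independent (alpha : br X -> K) (s : seq (br X)) : uniq s ->
  (forall t, t \in s -> B t) -> \sum_(t <- s) alpha t *: ev i t = 0 ->
  forall t, t \in s -> alpha t = 0.
Proof.
move=> us Bs sum0 t ts.
(* With all subtrees in [R], every left factor is there too, so [act] is the evaluation by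
   commutators before any elimination. *)
pose R := undup (flatten [seq subtrees c | c <- s]).
have memR c : reflect (exists2 d, d \in s & c \in subtrees d) (c \in R).
  rewrite mem_undup; apply: (iffP flattenP) => [[_ /mapP[d ds ->]]|[d ds cd]].
    by exists d.
  by exists (subtrees d) => //; apply: map_f.
have sR c : c \in s -> c \in R.
  by move=> cs; apply/memR; exists c => //; apply: subtrees_refl.
have BR c : c \in R -> B c by case/memR=> d /Bs; apply: hall_subtrees.
have R_node l r : Node l r \in R -> l \in R /\ r \in R.
  by case/memR=> d ds /subtrees_node[ld rd]; split; apply/memR; exists d.
pose beta c := if c \in s then alpha c else 0.
suff /(_ t (sR t ts)) : forall c, c \in R -> beta c = 0 by rewrite /beta ts.
apply: vanishing_eq0 => //; first exact: undup_uniq.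
  by move=> l r /R_node[].
move=> V f lin_f v.
pose e c : endo V := Endo (introT (linear_funP _) (lin_f c)).
have [g [[[lin_g lie_g] g_gen] _]] := free (fun x => e (Leaf x)).
have g_ev c : c \in R -> g (ev i c) = act f R c :> (V -> V).
  elim: c => [x|l IHl r IHr] cR /=; first by rewrite g_gen.
  by have [lR rR] := R_node _ _ cR; rewrite lR lie_g /= IHl ?IHr.
have g_sum (r : seq (br X)) : g (\sum_(c <- r) beta c *: ev i c) v
    = \sum_(c <- r) beta c *: g (ev i c) v.
  elim: r => [|c r IHr]; last by rewrite !big_cons lin_g -IHr.
  rewrite !big_nil; have := lin_g (-1) 0 0.
  by rewrite !scaleN1r !addNr => ->.
transitivity (g (\sum_(c <- R) beta c *: ev i c) v).
  by rewrite g_sum; apply: eq_big_seq => c cR; rewrite g_ev.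
have -> : \sum_(c <- R) beta c *: ev i c = 0.
  rewrite (bigID (mem s)) /= [X in _ + X]big1 ?addr0; last first.
    by move=> c cs; rewrite /beta ifN ?scale0r.
  rewrite -big_filter; transitivity (\sum_(c <- s) beta c *: ev i c).
    apply: perm_big; apply: uniq_perm => //; first exact/filter_uniq/undup_uniq.
    by move=> c; rewrite mem_filter; case cs: (c \in s) => //=; rewrite sR.
  by rewrite -[RHS]sum0; apply: eq_big_seq => c cs; rewrite /beta cs.
by have := g_sum [::]; rewrite !big_nil.
Qed.

End Independence.

(** * Trees over an alphabet of Hall elements *)

Section HallTrees.
Local Open Scope nat_scope.
Variables (X : Type) (B : set (br X)) (lt : rel (br X)).
Hypothesis HB : hall_set B lt.

Definition hall_le (a b : br X) : Prop := a = b \/ lt a b.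

Lemma hall_le_or_lt a b : B a -> B b -> hall_le a b \/ lt b a.
Proof.
by move=> Ba Bb; case: (hall_total HB Ba Bb); [left; right|left; left|right].
Qed.

Lemma hall_le_lt_trans a b c : B a -> B b -> B c -> hall_le a b -> lt b c -> lt a c.
Proof. by move=> Ba Bb Bc [->|ab] // bc; apply: (hall_trans HB Ba Bb Bc). Qed.

Lemma hall_lt_le_trans a b c : B a -> B b -> B c -> lt a b -> hall_le b c -> lt a c.
Proof. by move=> Ba Bb Bc ab [<-|bc] //; apply: (hall_trans HB Ba Bb Bc). Qed.

Lemma hall_le_trans a b c : B a -> B b -> B c ->
  hall_le a b -> hall_le b c -> hall_le a c.
Proof.
by move=> Ba Bb Bc [->|ab] // bc; right; apply: (hall_lt_le_trans Ba Bb Bc).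
Qed.

Lemma hall_le_anti a b : B a -> B b -> hall_le a b -> hall_le b a -> a = b.
Proof. by move=> Ba Bb [//|ab] [//|ba]; case: (hall_asym HB Ba Bb). Qed.

Definition left_le (x y : br X) : Prop := if x is Node l _ then hall_le l y else True.

Lemma left_le_trans x y z : B x -> B y -> B z ->
  left_le x y -> hall_le y z -> left_le x z.
Proof.
case: x => // l r Bx; have [Bl _ _ _] := (hall_node HB l r).1 Bx.
exact: hall_le_trans.
Qed.

Lemma left_le_refl x : B x -> left_le x x.
Proof. by case: x => // l r Bx; right; apply: (left_factor_lt HB). Qed.

Lemma hall_nodeP a b :
  B (Node a b) <-> [/\ B a, B b, lt a b & left_le b a].
Proof. exact: hall_node. Qed.

(* Such letters form the alphabet of a free Lie subalgebra, in which the Hall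
   trees over the letters are again the elements of [B]. *)
Definition alphabetic (S : seq (br X)) : Prop :=
  (forall x, x \in S -> B x) /\ (forall x y, x \in S -> y \in S -> left_le x y).

Lemma alphabetic_sub S S' : {subset S' <= S} -> alphabetic S -> alphabetic S'.
Proof. by move=> sS [BS lS]; split=> [x /sS|x y /sS xS /sS]; [apply: BS|apply: lS]. Qed.

Lemma alphabetic_node S x y : alphabetic S -> x \in S -> y \in S -> lt x y ->
  B (Node x y).
Proof.
case=> BS lS xS yS xy; apply/hall_nodeP.
by split=> //; [apply: BS|apply: BS|apply: lS].
Qed.

(** A new letter (h,y) has left factor h, which is at most every letter, old or new; the left factor
    of an old letter is at most h, hence at most every new letter. *)
Lemma alphabetic_extend S S' h : alphabetic S -> h \in S ->
  (forall x, x \in S -> hall_le h x) ->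
  (forall x, x \in S' -> x \in S \/ exists2 y, x = Node h y & B x) ->
  alphabetic S'.
Proof.
move=> [BS lS] hS hmin S'P.
have BS' x : x \in S' -> B x by case/S'P=> [/BS|[]].
have h_le x : x \in S' -> hall_le h x.
  move=> xS'; case: (S'P x xS') => [/hmin//|[y xE Bx]].
  by right; rewrite xE in Bx *; apply: (left_factor_lt HB).
split=> // x y xS' yS'; case: (S'P x xS') => [xS|[x' -> _]]; last exact: h_le.
exact: (left_le_trans (BS _ xS) (BS _ hS) (BS' _ yS') (lS _ _ xS hS) (h_le _ yS')).
Qed.

(* A tree whose leaves are labelled by trees is a bracket of letters taken in
   some alphabet; [flat] forgets the choice of the alphabet. *)
Fixpoint flat (t : br (br X)) : br X :=
  match t with Leaf x => x | Node a b => Node (flat a) (flat b) end.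

Fixpoint leaves (t : br (br X)) : seq (br X) :=
  match t with Leaf x => [:: x] | Node a b => leaves a ++ leaves b end.

Lemma size_leaves t : size (leaves t) = br_size t.
Proof. by elim: t => //= a IHa b IHb; rewrite size_cat IHa IHb. Qed.

Lemma hall_flat a b : B (flat (Node a b)) ->
  [/\ B (flat a), B (flat b), lt (flat a) (flat b) & left_le (flat b) (flat a)].
Proof. by move=> /(hall_nodeP (flat a) (flat b)).1. Qed.

Lemma br_size_gt0 (Y : Type) (t : br Y) : 0 < br_size t.
Proof. by elim: t => //= a + b _; case: br_size. Qed.

(** The leftmost leaf will do, since a left factor precedes its node. *)
Lemma leaf_le_flat t : B (flat t) ->
  exists2 x, x \in leaves t & B x /\ hall_le x (flat t).
Proof.
elim: t => [x|a IHa b _] ; first by exists x; rewrite ?mem_head //; split=> //; left.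
move=> Bab; have [Ba _ _ _] := hall_flat Bab.
have [x xa [Bx xle]] := IHa Ba; exists x; first by rewrite mem_cat xa.
split=> //; right; apply: (hall_le_lt_trans Bx Ba Bab xle); exact: (left_factor_lt HB).
Qed.

(** * Contexts and marked leaves *)

Local Notation context := (seq (br (br X))).

Definition plug (C : context) (t : br (br X)) : br (br X) := foldr (@Node _) t C.

Definition cleaves (C : context) : seq (br X) := flatten (map leaves C).

Lemma cleaves_cat C D : cleaves (C ++ D) = cleaves C ++ cleaves D.
Proof. by rewrite /cleaves map_cat flatten_cat. Qed.

Lemma cleaves_cons s C : cleaves (s :: C) = leaves s ++ cleaves C.
Proof. by []. Qed.

Lemma cleaves_rcons C s : cleaves (rcons C s) = cleaves C ++ leaves s.
Proof. by rewrite -cats1 cleaves_cat /cleaves /= cats0. Qed.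

Lemma leaves_plug C t : leaves (plug C t) = cleaves C ++ leaves t.
Proof. by elim: C => //= s C ->; rewrite /cleaves /= catA. Qed.

(* The leaves of [t], each with the siblings met on the path from the root:
   forgetting the sides changes the bracket at most by a sign. *)
Fixpoint marks (t : br (br X)) : seq (context * br X) :=
  match t with
  | Leaf x => [:: ([::], x)]
  | Node a b => [seq (b :: p.1, p.2) | p <- marks a]
             ++ [seq (a :: p.1, p.2) | p <- marks b]
  end.

Lemma size_marks t : size (marks t) = br_size t.
Proof. by elim: t => //= a IHa b IHb; rewrite size_cat !size_map IHa IHb. Qed.

Lemma marks_perm t p : p \in marks t -> perm_eq (leaves t) (p.2 :: cleaves p.1).
Proof.
elim: t p => [x|a IHa b IHb] p /=; first by rewrite inE => /eqP ->.
rewrite mem_cat => /orP[] /mapP[q qm ->] /=; rewrite /cleaves /= -/(cleaves _).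
  by rewrite perm_catC -cat1s perm_sym perm_catCA perm_cat2l perm_sym IHa.
by rewrite -cat1s perm_sym perm_catCA perm_cat2l perm_sym IHb.
Qed.

Lemma marks_size t p : p \in marks t -> br_size t = (size (cleaves p.1)).+1.
Proof. by move/marks_perm/perm_size; rewrite size_leaves. Qed.

Lemma marks_exists t x : x \in leaves t -> exists2 p, p \in marks t & p.2 = x.
Proof.
elim: t => [y|a IHa b IHb] /=.
  by rewrite inE => /eqP->; exists ([::], y); rewrite ?mem_head.
rewrite mem_cat => /orP[/IHa|/IHb] [p pm <-].
  by exists (b :: p.1, p.2) => //; rewrite mem_cat (map_f (fun p => (b :: p.1, p.2))).
exists (a :: p.1, p.2) => //.
by rewrite mem_cat (map_f (fun p => (a :: p.1, p.2)) pm) orbT.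
Qed.

Lemma br_size_gt1 (Y : Type) (a b : br Y) : 1 < br_size (Node a b).
Proof. by rewrite /= (leq_add (br_size_gt0 a) (br_size_gt0 b)). Qed.

Lemma leaf_or_size_gt1 (Y : Type) (t : br Y) : (exists y, t = Leaf y) \/ 1 < br_size t.
Proof. by case: t => [y|a b]; [left; exists y|right; apply: br_size_gt1]. Qed.

Lemma marks_sibling t p : 1 < br_size t -> p \in marks t ->
  exists D s, p.1 = rcons D s.
Proof.
case: t => // a b _; rewrite /= mem_cat => /orP[] /mapP[q _ ->] /=.
  by exists (belast b q.1), (last b q.1); rewrite lastI.
by exists (belast a q.1), (last a q.1); rewrite lastI.
Qed.

(** The last entry of a context is the innermost one, the sibling of the marked leaf itself; 0
    arises only for the empty context. *)
Definition sib (C : context) : nat := last 0 (map (@br_size _) C).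

Lemma sib_rcons C s : sib (rcons C s) = br_size s.
Proof. by rewrite /sib map_rcons last_rcons. Qed.

(** Equality holds for a comb. Induction on the tree: when both factors are nodes, the bound [T] is
    superadditive; a factor that is a leaf has the whole other factor as its sibling. *)
Lemma sum_sib (w : nat -> nat) t : {homo w : m n / m <= n} -> 1 < br_size t ->
  \sum_(p <- marks t) w (sib p.1) <= w 1 + \sum_(1 <= k < br_size t) w k.
Proof.
move=> w_homo; pose T m := w 1 + \sum_(1 <= k < m) w k.
have TS m : 0 < m -> T m.+1 = T m + w m.
  by move=> m0; rewrite /T big_nat_recr //= addnA.
have T_super m1 m2 : 1 < m1 -> 0 < m2 -> T m1 + T m2 <= T (m1 + m2).
  move=> m1_gt1; elim: m2 => // -[_ _|m2 IH _].
    rewrite addn1 (TS m1 (ltnW m1_gt1)) leq_add2l /T big_geq // addn0.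
    exact/w_homo/ltnW.
  rewrite addnS (TS m2.+1) // (TS (m1 + m2.+1)) ?addnS // -addnS addnA.
  by apply: leq_add; [apply: IH|apply/w_homo/leq_addl].
(* [U t m] is the share of a factor [t] whose sibling has size [m]; the empty context means that the
   factor is itself the leaf. *)
pose U t m := \sum_(p <- marks t) (if p.1 is [::] then w m else w (sib p.1)).
have UE a b : \sum_(p <- marks (Node a b)) w (sib p.1)
    = U a (br_size b) + U b (br_size a).
  rewrite /= big_cat /= !big_map; congr (_ + _).
    by apply: eq_bigr => -[[|s C] x].
  by apply: eq_bigr => -[[|s C] x].
have UN s m : 1 < br_size s -> U s m = \sum_(p <- marks s) w (sib p.1).
  move=> s_gt1; apply: eq_big_seq => p /(marks_sibling s_gt1)[D [c ->]].
  by case: D.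
have UL x m : U (Leaf x) m = w m by rewrite /U /= big_seq1.
rewrite -/(T _); elim: t => [//|a IHa b IHb] _; rewrite UE /=.
have [[x aE]|a_gt1] := leaf_or_size_gt1 a; have [[y bE]|b_gt1] := leaf_or_size_gt1 b.
- by rewrite aE bE !UL /= addn1 TS // /T big_geq // addn0.
- by rewrite aE UL UN //= add1n TS ?br_size_gt0 // addnC leq_add2r IHb.
- by rewrite bE UL UN //= addn1 TS ?br_size_gt0 // leq_add2r IHa.
rewrite !UN //; apply: leq_trans (T_super _ _ a_gt1 (ltnW b_gt1)).
by apply: leq_add; [apply: IHa|apply: IHb].
Qed.

Lemma marks_hall t p : B (flat t) -> p \in marks t ->
  forall c, c \in p.1 -> B (flat c).
Proof.
elim: t p => [x|a IHa b IHb] p Bt; first by rewrite inE => /eqP ->.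
have [Ba Bb _ _] := hall_flat Bt.
rewrite /= mem_cat => /orP[] /mapP[q qm ->] c /=; rewrite inE => /orP[/eqP-> //|].
  exact: IHa qm c.
exact: IHb qm c.
Qed.

(** Restores the last hypothesis of [derivation_bound] when the sibling [s] takes the role of b. The
    clause on the left factor of [t] carries the induction and serves to reach the outer context. *)
Lemma marks_left_le t p D s : B (flat t) -> p \in marks t -> p.1 = rcons D s ->
  (forall c, c \in D -> left_le (flat s) (flat c)) /\
  (if t is Node t1 _ then left_le (flat s) (flat t1) else True).
Proof.
elim: t p D s => [x|a IHa b IHb] p D s Bt.
  by rewrite inE => /eqP -> /=; case: D.
have [Ba Bb ab lba] := hall_flat Bt.
have Bs : p \in marks (Node a b) -> p.1 = rcons D s -> B (flat s).
  by move=> /(marks_hall Bt) + pE; apply; rewrite pE mem_rcons mem_head.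
move=> pm pE; have {}Bs := Bs pm pE.
move: pm pE; rewrite /= mem_cat => /orP[] /mapP[[[|q1 q] x] qm ->] /=.
- by case: D => [[<-]|? []//]; split.
- rewrite lastI => /rcons_inj[/= <- sE].
  have [IH1 IH2] := IHa _ _ _ Ba qm (lastI q1 q).
  rewrite sE in IH1 IH2.
  case: a {IHa} Ba ab lba qm IH2 {Bt} => [y|a1 a2] Ba ab lba qm IH2.
    by move: qm; rewrite inE.
  have [Ba1 _ _ _] := hall_flat Ba.
  have la : left_le (flat s) (flat (Node a1 a2)).
    apply: (left_le_trans Bs Ba1 Ba IH2); right; exact: (left_factor_lt HB).
  split=> // c; rewrite inE => /orP[/eqP->|/IH1//].
  by apply: (left_le_trans Bs Ba Bb la); right.
- case: D => [[<-]|? []//]; split=> //; exact: left_le_refl.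
- rewrite lastI => /rcons_inj[/= <- sE].
  have [IH1 IH2] := IHb _ _ _ Bb qm (lastI q1 q).
  rewrite sE in IH1 IH2.
  case: b {IHb} Bb ab lba qm IH2 {Bt} => [y|b1 b2] Bb ab lba qm IH2.
    by move: qm; rewrite inE.
  have [Bb1 _ _ _] := hall_flat Bb.
  have la : left_le (flat s) (flat a) by apply: (left_le_trans Bs Bb1 Ba IH2).
  by split=> // c; rewrite inE => /orP[/eqP->|/IH1//].
Qed.

(* What is needed of a t' obtained from t by merging a subtree (h,y) made of two
   letters into a single letter. *)
Definition merges (h : br X) (t t' : br (br X)) : Prop :=
  [/\ flat t' = flat t, br_size t = (br_size t').+1 &
   forall x, x \in leaves t' -> x \in leaves t \/ exists2 y, x = Node h y & B x].

Lemma merges_left h a a' b : merges h a a' -> merges h (Node a b) (Node a' b).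
Proof.
move=> [fE sE lE]; split=> /=; rewrite ?fE ?sE // => x; rewrite !mem_cat.
by case/orP=> [/lE[->|]|->]; [left|right|left; rewrite orbT].
Qed.

Lemma merges_right h a b b' : merges h b b' -> merges h (Node a b) (Node a b').
Proof.
move=> [fE sE lE]; split=> /=; rewrite ?fE ?sE ?addnS // => x; rewrite !mem_cat.
by case/orP=> [->|/lE[->|]]; [left|left; rewrite orbT|right].
Qed.

Definition cmerges (h : br X) (C C' : context) : Prop :=
  exists C1 s s' C2, [/\ C = C1 ++ s :: C2, C' = C1 ++ s' :: C2 & merges h s s'].

Lemma cmerges_cons h s C C' : cmerges h C C' -> cmerges h (s :: C) (s :: C').
Proof. by move=> [C1 [u [u' [C2 [-> -> m]]]]]; exists (s :: C1), u, u', C2. Qed.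

Lemma cmerges_catr h C D D' : cmerges h D D' -> cmerges h (C ++ D) (C ++ D').
Proof.
move=> [C1 [u [u' [C2 [-> -> m]]]]]; exists (C ++ C1), u, u', C2.
by rewrite -!catA.
Qed.

Lemma cmerges_size h C C' : cmerges h C C' -> size (cleaves C) = (size (cleaves C')).+1.
Proof.
move=> [C1 [u [u' [C2 [-> -> [_ sE _]]]]]].
by rewrite !cleaves_cat !cleaves_cons !size_cat !size_leaves sE addnS.
Qed.

Lemma cmerges_leaves h C C' : cmerges h C C' ->
  forall x, x \in cleaves C' -> x \in cleaves C \/ exists2 y, x = Node h y & B x.
Proof.
move=> [C1 [u [u' [C2 [-> -> [_ _ lE]]]]]] x.
rewrite !cleaves_cat !cleaves_cons !mem_cat.
by case/or3P=> [->|/lE[->|]|->]; rewrite ?orbT; [left|left|right|left].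
Qed.

(** In the second case h is the sibling of the mark, so a letter above h put at the mark forms a
    single letter with it. *)
Definition spared (h : br X) (C : context) : Prop :=
  (exists C', cmerges h C C') \/ (exists D, C = rcons D (Leaf h)).

Lemma spared_cons h s C : spared h C -> spared h (s :: C).
Proof.
case=> [[C' m]|[D ->]]; first by left; exists (s :: C'); apply: cmerges_cons.
by right; exists (s :: D).
Qed.

(** Some leaf x has x <= t <= h <= x, the last by minimality. *)
Lemma min_in_leaves (S : seq (br X)) t h :
  (forall x, x \in S -> B x) -> {subset leaves t <= S} ->
  h \in S -> (forall x, x \in S -> hall_le h x) ->
  B (flat t) -> hall_le (flat t) h -> h \in leaves t.
Proof.
move=> BS tS hS hmin Bt th; have [x xt [Bx xle]] := leaf_le_flat Bt.
suff -> : h = x by [].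
apply: (hall_le_anti (BS _ hS) Bx (hmin _ (tS _ xt))).
exact: (hall_le_trans Bx Bt (BS _ hS)).
Qed.

(* In a Hall tree, the minimal letter h always sits in some subtree (h,y) with y
   a letter; the marks other than that occurrence of h leave it mergeable. *)
Lemma min_merges S h t : alphabetic S -> {subset leaves t <= S} ->
  (forall x, x \in S -> hall_le h x) -> B (flat t) -> h \in leaves t -> 1 < br_size t ->
  (exists t', merges h t t') /\
  exists m1 p0 m2, [/\ marks t = m1 ++ p0 :: m2, sib p0.1 = 1
    & forall p, p \in m1 ++ m2 -> spared h p.1].
Proof.
move=> aS + hmin; have BS := aS.1.
elim: t => [//|t1 IH1 t2 IH2] tS Bt ht _.
have hS := tS _ ht.
have t1S : {subset leaves t1 <= S} by move=> x xt; apply: tS; rewrite /= mem_cat xt.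
have t2S : {subset leaves t2 <= S}.
  by move=> x xt; apply: tS; rewrite /= mem_cat xt orbT.
have [B1 B2 lt12 l21] := hall_flat Bt.
have size_node := @br_size_gt1 (br X).
(* If [t1] is h and [t2] is a node, the left factor of [t2] is at most h and so contains h; if [t2]
   is h, then t1 < h contains h and is not a letter. *)
have : [\/ h \in leaves t1 /\ 1 < br_size t1, h \in leaves t2 /\ 1 < br_size t2
         | t1 = Leaf h /\ exists y, t2 = Leaf y].
  move: ht; rewrite /= mem_cat => /orP[h1|h2].
    case: t1 h1 {IH1 t1S B1 Bt tS} lt12 l21 => [x|a b] h1 lt12 l21.
      2: by constructor 1.
    have xE : x = h by move: h1; rewrite inE => /eqP.
    rewrite {}xE {h1 lt12} in l21 *.
    case: t2 {IH2} t2S B2 l21 => [y|a b] t2S B2 ah.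
      by constructor 3; split=> //; exists y.
    constructor 2; split; last exact: size_node.
    rewrite /= mem_cat.
    have [Ba _ _ _] := hall_flat B2.
    have aS' : {subset leaves a <= S} by move=> z za; apply: t2S; rewrite /= mem_cat za.
    by rewrite (min_in_leaves BS aS' hS hmin Ba ah).
  case: t2 h2 {IH2 t2S l21 Bt tS} B2 lt12 => [x|a b] h2 B2 lt12; last by constructor 2.
  have xE : x = h by move: h2; rewrite inE => /eqP.
  rewrite /= xE in lt12.
  have h1 : h \in leaves t1 by apply: (min_in_leaves BS t1S hS hmin B1); right.
  case: t1 h1 {IH1 t1S} B1 lt12 => [y|a b] h1 B1 lt12; last by constructor 1.
  move: h1 lt12; rewrite inE => /eqP <- /=.
  by case/(hall_irrF HB (BS _ hS)).
case=> [[h1 s1]|[h2 s2]|[E1 [y E2]]].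
- have [[t' mt'] [m1 [p0 [m2 [mE s0 mP]]]]] := IH1 t1S B1 h1 s1.
  split; first by exists (Node t' t2); apply: merges_left.
  exists [seq (t2 :: p.1, p.2) | p <- m1], (t2 :: p0.1, p0.2),
    ([seq (t2 :: p.1, p.2) | p <- m2] ++ [seq (t1 :: p.1, p.2) | p <- marks t2]).
  split; first by rewrite /= mE map_cat /= -catA.
    by case: p0 s0 {mE} => -[|c C].
  move=> p; rewrite catA mem_cat -map_cat => /orP[] /mapP[q qm ->] /=.
    by apply: spared_cons; apply: mP.
  by left; exists (t' :: q.1); exists [::], t1, t', q.1.
- have [[t' mt'] [m1 [p0 [m2 [mE s0 mP]]]]] := IH2 t2S B2 h2 s2.
  split; first by exists (Node t1 t'); apply: merges_right.
  exists ([seq (t2 :: p.1, p.2) | p <- marks t1] ++ [seq (t1 :: p.1, p.2) | p <- m1]),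
    (t1 :: p0.1, p0.2), [seq (t1 :: p.1, p.2) | p <- m2].
  split; first by rewrite /= mE map_cat /= -catA.
    by case: p0 s0 {mE} => -[|c C].
  move=> p; rewrite -catA mem_cat -map_cat => /orP[] /mapP[q qm ->] /=.
    by left; exists (t' :: q.1); exists [::], t2, t', q.1.
  by apply: spared_cons; apply: mP.
rewrite {}E1 {}E2 in Bt *; split.
  exists (Leaf (Node h y)); split=> // x; rewrite inE => /eqP->.
  by right; exists y.
(* The exceptional mark is h in (h,y), where a merge would swallow the mark; its sibling y has size
   1. *)
exists [::], ([:: Leaf y], h), [:: ([:: Leaf h], y)]; split=> // p.
by rewrite /= inE => /eqP ->; right; exists [::].
Qed.

End HallTrees.

(** * The recursion for the number of terms *)

Section Weight.
Local Open Scope nat_scope.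

(** Bounds the number of terms when a minimal letter acts on a tree of [m] letters inside a context,
    [n] + 1 letters in all. The factorial pays for the one leaf that may miss a merge, the sum for
    the others. *)
Fixpoint weight (n m : nat) : nat :=
  match n with
  | 0 => 1
  | n'.+1 => n'.+1`! + \sum_(1 <= k < m) weight n' k
  end.

Lemma weight1 n : weight n 1 = n`!.
Proof. by case: n => //= n; rewrite big_geq ?addn0. Qed.

Lemma weight_homo n : {homo weight n : m p / m <= p}.
Proof.
case: n => //= n [|m] [|p] // mp.
  by rewrite [X in _ + X <= _]big_geq // leq_add2l.
by rewrite leq_add2l [leqRHS](big_cat_nat _ (n := m.+1)) //= leq_addr.
Qed.

Lemma weight_ge_fact n m : n`! <= weight n m.
Proof. by case: n => //= n; rewrite leq_addr. Qed.

Lemma weight_succ n m : 0 < m -> weight n.+1 m.+1 = weight n.+1 m + weight n m.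
Proof. by move=> m0 /=; rewrite big_nat_recr //= addnA. Qed.

(** Induction on [m], in which [weight_succ] corresponds to Pascal's rule. *)
Lemma weightE n m : m <= n -> weight n m.+1 = \sum_(k < m.+1) 'C(m, k) * (n - k)`!.
Proof.
elim: m n => [|m IHm] [|n] // mn.
- by rewrite big_ord1.
- by rewrite weight1 big_ord1 mul1n subn0.
rewrite weight_succ // IHm 1?ltnW // IHm //.
rewrite [in RHS]big_ord_recl [in LHS]big_ord_recl /= !bin0 -addnA; congr (_ + _).
under [RHS]eq_bigr => k _ do rewrite /bump /= add1n binS mulnDl subSS.
rewrite big_split /= [X in _ = X + _]big_ord_recr /= bin_small // mul0n addn0.
by congr (_ + _).
Qed.

Lemma weight_diag_homo m n : m <= n -> weight m m.+1 <= weight n n.+1.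
Proof.
elim: n => [|n IHn]; first by rewrite leqn0 => /eqP->.
rewrite leq_eqVlt => /orP[/eqP->//|/IHn] /leq_trans; apply.
by rewrite (weight_succ n (ltn0Sn n)) leq_addl.
Qed.

End Weight.

(** On the diagonal the terms of [weightE] are n!/k!, so the weight is n! times a partial sum of the
    series of e. *)
Lemma weight_diag_expR (R : realType) (n : nat) :
  (weight n n.+1)%:R <= expR 1 * n`!%:R :> R.
Proof.
have -> : (weight n n.+1)%:R = series (exp_coeff 1) n.+1 * n`!%:R :> R.
  rewrite weightE // natr_sum /series /= big_mkord big_distrl /=.
  apply: eq_bigr => k _; rewrite /exp_coeff /= expr1n mul1r.
  have kn : (k <= n)%N by rewrite -ltnS.
  have fk0 : k`!%:R != 0 :> R by rewrite pnatr_eq0 -lt0n fact_gt0.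
  apply: (mulfI fk0); rewrite mulrA divff // mul1r -natrM.
  by congr (_%:R); rewrite mulnA [(k`! * _)%N]mulnC -mulnA bin_fact.
rewrite ler_pM2r ?ltr0n ?fact_gt0 //.
apply: nondecreasing_cvgn_le; last exact: is_cvg_series_exp_coeff.
apply/nondecreasing_seqP => m.
by rewrite /series /= big_nat_recr //= lerDl exp_coeff_ge0.
Qed.

(** * Bounding brackets *)

Section LieBounds.
Variables (K : numFieldType) (X : Type) (L : lieAlgType K) (i : X -> L).
Variables (B : set (br X)) (lt : rel (br X)).
Hypothesis HB : hall_set B lt.

Lemma lieDl (x y z : L) : lie (x + y) z = lie x z + lie y z.
Proof. by have := lie_linearl z 1 x y; rewrite !scale1r. Qed.

Lemma lieDr (x y z : L) : lie x (y + z) = lie x y + lie x z.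
Proof. by have := lie_linearr x 1 y z; rewrite !scale1r. Qed.

Lemma lie0r (x : L) : lie x 0 = 0.
Proof. by apply: (addrI (lie x 0)); rewrite -lieDr !addr0. Qed.

Lemma lieNr (x y : L) : lie x (- y) = - lie x y.
Proof. by apply: (addrI (lie x y)); rewrite -lieDr !subrr lie0r. Qed.

Lemma lieC (x y : L) : lie x y = - lie y x.
Proof.
apply/eqP; rewrite -addr_eq0; have := liexx (x + y).
by rewrite lieDl !lieDr !liexx addr0 add0r => ->.
Qed.

Lemma lie_derivation (u x y : L) : lie u (lie x y) = lie x (lie u y) - lie y (lie u x).
Proof.
have /eqP := lie_jacobi u x y; rewrite -addrA addr_eq0 => /eqP ->.
by rewrite (lieC y u) lieNr opprD opprK; congr (_ - _).
Qed.

(** * Signed sums of Hall elements *)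

Definition hall_bounded (u : L) (n : nat) : Prop :=
  exists s : seq (bool * br X), [/\ forall p, p \in s -> B p.2, (size s <= n)%N
    & u = \sum_(p <- s) (-1) ^+ p.1 *: ev i p.2].

Lemma hall_bounded0 n : hall_bounded 0 n.
Proof. by exists [::]; rewrite big_nil. Qed.

Lemma hall_bounded_ev t n : B t -> (0 < n)%N -> hall_bounded (ev i t) n.
Proof.
move=> Bt n0; exists [:: (false, t)]; split=> // [p|].
  by rewrite inE => /eqP ->.
by rewrite big_seq1 scale1r.
Qed.

Lemma hall_bounded_leq m n u : (m <= n)%N -> hall_bounded u m -> hall_bounded u n.
Proof. by move=> mn [s [Bs sm ->]]; exists s; split=> //; apply: leq_trans mn. Qed.

Lemma hall_boundedD m n u v : hall_bounded u m -> hall_bounded v n ->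
  hall_bounded (u + v) (m + n).
Proof.
move=> [s [Bs sm ->]] [r [Br rn ->]]; exists (s ++ r); split.
- by move=> p; rewrite mem_cat => /orP[/Bs|/Br].
- by rewrite size_cat leq_add.
- by rewrite big_cat.
Qed.

Lemma hall_boundedN n u : hall_bounded (- u) n <-> hall_bounded u n.
Proof.
suff H v : hall_bounded v n -> hall_bounded (- v) n.
  by split=> [/H|/H //]; rewrite opprK.
move=> [s [Bs sn ->]]; exists [seq (~~ p.1, p.2) | p <- s]; split.
- by move=> _ /mapP[p ps ->]; exact: Bs ps.
- by rewrite size_map.
rewrite big_map -sumrN; apply: eq_bigr => -[b t] _ /=.
by rewrite signrN scaleNr.
Qed.

Notation tev t := (ev i (flat t)).

Definition ad (C : seq (br (br X))) (u : L) : L := foldr (fun s v => lie (tev s) v) u C.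

Lemma ad_cat C D u : ad (C ++ D) u = ad C (ad D u).
Proof. exact: foldr_cat. Qed.

Lemma ad_rcons C s u : ad (rcons C s) u = ad C (lie (tev s) u).
Proof. by rewrite -cats1 ad_cat. Qed.

Lemma ad_plug C t : ad C (tev t) = tev (plug C t).
Proof. by elim: C => //= s C ->. Qed.

Lemma adN C u : ad C (- u) = - ad C u.
Proof. by elim: C => //= s C ->; rewrite lieNr. Qed.

Lemma adD C u v : ad C (u + v) = ad C u + ad C v.
Proof. by elim: C => //= s C ->; rewrite lieDr. Qed.

Lemma ad0 C : ad C 0 = 0.
Proof. by elim: C => //= s C ->; rewrite lie0r. Qed.

Lemma ad_cmerges h C C' u : cmerges B h C C' -> ad C' u = ad C u.
Proof. by move=> [C1 [s [s' [C2 [-> -> [fE _ _]]]]]]; rewrite !ad_cat /= fE. Qed.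

Lemma marks_ev t p : p \in marks t ->
  tev t = ad p.1 (ev i p.2) \/ tev t = - ad p.1 (ev i p.2).
Proof.
elim: t p => [x|a IHa b IHb] p /=; first by rewrite inE => /eqP -> /=; left.
rewrite mem_cat => /orP[] /mapP[q qm ->] /=.
  rewrite lieC; case: (IHa q qm) => ->; first by right.
  by left; rewrite lieNr opprK.
case: (IHb q qm) => ->; first by left.
by right; rewrite lieNr.
Qed.

(** Bracketing with [u] is a derivation, so it distributes over the leaves of [t]; [C] collects the
    siblings passed on the way down. *)
Lemma hall_bounded_marks t C u (f : seq (br (br X)) * br X -> nat) :
  (forall p, p \in marks t ->
    hall_bounded (ad C (ad p.1 (lie u (ev i p.2)))) (f p)) ->
  hall_bounded (ad C (lie u (tev t))) (\sum_(p <- marks t) f p).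
Proof.
elim: t C f => [x|a IHa b IHb] C f H.
  by rewrite /= big_seq1; apply: (H ([::], x)); rewrite mem_head.
rewrite [flat _]/= [ev i (Node _ _)]/= lie_derivation adD addrC.
rewrite [marks _]/= big_cat /= !big_map; apply: hall_boundedD.
  rewrite adN; apply/hall_boundedN.
  have -> v : ad C (lie (tev b) v) = ad (rcons C b) v by rewrite ad_rcons.
  apply: (IHa _ (fun p => f (b :: p.1, p.2))) => p pm; rewrite ad_rcons.
  by apply: (H (b :: p.1, p.2)); rewrite mem_cat (map_f (fun p => (b :: p.1, p.2))).
have -> v : ad C (lie (tev a) v) = ad (rcons C a) v by rewrite ad_rcons.
apply: (IHb _ (fun p => f (a :: p.1, p.2))) => p pm; rewrite ad_rcons.
apply: (H (a :: p.1, p.2)).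
by rewrite mem_cat (map_f (fun p => (a :: p.1, p.2)) pm) orbT.
Qed.

(* Eliminate the minimal letter h: it acts as a derivation on its sibling, and
   each [h, y] is a single letter of the next alphabet. *)
Lemma alphabetic_tree_bound n t : br_size t = n.+1 -> alphabetic B lt (leaves t) ->
  hall_bounded (tev t) n`!.
Proof.
elim: n t => [|n IHn] t.
  case: t => [x _ [BS _]|a b sab]; last by have := br_size_gt1 a b; rewrite sab.
  by apply: hall_bounded_ev => //; apply: BS; rewrite mem_head.
move=> st aS; have [BS _] := aS.
have SN0 : leaves t != [::] by rewrite -size_eq0 size_leaves st.
have [h hS hmin] := hall_min HB SN0 BS.
have [p pm pE] := marks_exists hS.
have := marks_perm pm; have := marks_ev pm.
have [C [s ->]] : exists C s, p.1 = rcons C s.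
  by apply: marks_sibling pm; rewrite st.
rewrite pE => tE tP.
suff H : hall_bounded (ad C (lie (ev i h) (tev s))) n.+1`!.
  case: tE => ->; rewrite ad_rcons lieC adN ?opprK //; exact/hall_boundedN.
have sz : (br_size s <= n.+1)%N.
  have := perm_size tP; rewrite /= cleaves_rcons size_cat !size_leaves st.
  lia.
apply: (@hall_bounded_leq (\sum_(q <- marks s) n`!)).
  rewrite big_const_seq count_predT size_marks iter_addn_0 mulnC factS.
  by rewrite leq_mul2r sz orbT.
apply: (hall_bounded_marks (f := fun=> n`!)) => q qm.
have memS x : x \in q.2 :: cleaves (C ++ q.1) -> x \in leaves t.
  rewrite (perm_mem tP) !inE cleaves_cat cleaves_rcons !mem_cat.
  rewrite (perm_mem (marks_perm qm)) inE.
  by case/or3P=> ->; rewrite ?orbT.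
have qS : q.2 \in leaves t by apply: memS; rewrite mem_head.
(* h may occur again inside its sibling, and there the bracket vanishes. *)
case: (hmin _ qS) => [<-|hq]; first by rewrite liexx !ad0; apply: hall_bounded0.
have Bhq := alphabetic_node HB aS hS qS hq.
have -> : lie (ev i h) (ev i q.2) = tev (Leaf (Node h q.2)) by [].
rewrite -ad_cat ad_plug; apply: IHn.
  have := perm_size tP; have := perm_size (marks_perm qm).
  rewrite -size_leaves leaves_plug cleaves_cat /= cleaves_rcons !size_cat.
  by rewrite !size_leaves st /=; lia.
apply: (alphabetic_extend HB aS hS hmin) => x.
rewrite leaves_plug mem_cat inE => /orP[xC|/eqP ->]; last by right; exists q.2.
by left; apply: memS; rewrite inE xC orbT.
Qed.

Local Open Scope nat_scope.

Lemma plug_bound n C g : size (cleaves C) = n -> alphabetic B lt (g :: cleaves C) ->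
  hall_bounded (ad C (ev i g)) n`!.
Proof.
move=> sC aS; have -> : ev i g = tev (Leaf g) by [].
rewrite ad_plug; apply: alphabetic_tree_bound.
  by rewrite -size_leaves leaves_plug size_cat addn1 sC.
by apply: alphabetic_sub aS => x; rewrite leaves_plug mem_cat !inE orbC.
Qed.

(* The case where g = [z, y] does not become the minimal letter: some subtree
   (h, y') merges into a letter before any branching occurs. *)
Lemma spared_bound n C g h S : alphabetic B lt (g :: S) -> hall_le lt h g -> h \in S ->
  (forall x, x \in S -> hall_le lt h x) -> {subset cleaves C <= S} ->
  size (cleaves C) = n.+1 -> spared B h C -> hall_bounded (ad C (ev i g)) n`!.
Proof.
move=> aS hg hS hmin CS sC.
have hS' : h \in g :: S by rewrite inE hS orbT.
have hmin' x : x \in g :: S -> hall_le lt h x by rewrite inE => /orP[/eqP->|/hmin].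
case=> [[C' m]|[D CE]].
  rewrite -(ad_cmerges _ m); apply: plug_bound.
    by move: sC; rewrite (cmerges_size m) => -[].
  apply: (alphabetic_extend HB aS hS' hmin') => x; rewrite inE => /orP[/eqP->|].
    by left; rewrite mem_head.
  by case/(cmerges_leaves m) => [/CS xS|]; [left; rewrite inE xS orbT|right].
rewrite CE ad_rcons /=; case: hg => [<-|hg].
  by rewrite liexx ad0; apply: hall_bounded0.
have Bhg := alphabetic_node HB aS hS' (mem_head _ _) hg.
have -> : lie (ev i h) (ev i g) = ev i (Node h g) by [].
apply: plug_bound.
  by move: sC; rewrite CE cleaves_rcons size_cat addn1 => -[].
apply: (alphabetic_extend HB aS hS' hmin') => x; rewrite inE => /orP[/eqP->|xD].
  by right; exists g.
by left; rewrite inE CS ?orbT // CE cleaves_rcons mem_cat xD.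
Qed.

Lemma alphabetic_new_letter S z y : alphabetic B lt (z :: S) ->
  (forall x, x \in S -> lt z x) -> y \in S -> alphabetic B lt (Node z y :: S).
Proof.
move=> azS zmin yS; have zS : z \in z :: S by rewrite mem_head.
have ySz : y \in z :: S by rewrite inE yS orbT.
apply: (alphabetic_extend HB azS zS) => x; rewrite inE => /orP[/eqP->|xS].
- by left.
- by right; apply: zmin.
- by right; exists y => //; apply: (alphabetic_node HB azS zS ySz (zmin _ yS)).
- by left; rewrite inE xS orbT.
Qed.

Lemma letter_derivation_bound n C y z : size (cleaves C) = n ->
  alphabetic B lt (z :: y :: cleaves C) ->
  (forall x, x \in y :: cleaves C -> lt z x) ->
  hall_bounded (ad C (lie (ev i z) (ev i y))) n`!.
Proof.
move=> sC azS zmin; apply: (@plug_bound n C (Node z y)) => //.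
apply: alphabetic_sub (alphabetic_new_letter azS zmin (mem_head _ _)) => x.
by rewrite !inE => /orP[->//|->]; rewrite !orbT.
Qed.

(** Induction on the number of letters besides [z], according to whether (z,y) becomes the new
    minimal letter for each leaf y of [b]. *)
Lemma derivation_bound n C b z : size (cleaves C) + br_size b = n.+1 ->
  alphabetic B lt (z :: leaves b ++ cleaves C) ->
  (forall x, x \in leaves b ++ cleaves C -> lt z x) ->
  B (flat b) -> (forall c, c \in C -> B (flat c)) ->
  (forall c, c \in C -> left_le lt (flat b) (flat c)) ->
  hall_bounded (ad C (lie (ev i z) (tev b))) (weight n (br_size b)).
Proof.
elim: n C b z => [|n IHn] C b z sCb azS zmin Bb BC bC.
all: have [[y bE]|b_gt1] := leaf_or_size_gt1 b.
1,3: by rewrite bE weight1; apply: letter_derivation_bound;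
  [move: sCb; rewrite bE addn1 => -[]|move: azS; rewrite bE|move: zmin; rewrite bE].
  by move: sCb b_gt1; lia.
set S := leaves b ++ cleaves C in azS zmin.
have az y : y \in S -> alphabetic B lt (Node z y :: S) by exact: alphabetic_new_letter.
have Bz y : y \in S -> B (Node z y) by move=> /az[+ _]; apply; rewrite mem_head.
have aS : alphabetic B lt S by apply: alphabetic_sub azS => x xS; rewrite inE xS orbT.
have [BS _] := aS.
have SN0 : S != [::] by rewrite -size_eq0 size_cat size_leaves addnC sCb.
have [h hS hmin] := hall_min HB SN0 BS.
have pS p : p \in marks b -> p.2 \in S.
  by move=> /marks_perm/perm_mem pE; rewrite mem_cat pE mem_head.
have pC p : p \in marks b -> {subset cleaves (C ++ p.1) <= S}.
  move=> /marks_perm/perm_mem pE x; rewrite cleaves_cat !mem_cat pE inE.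
  by case/orP=> ->; rewrite ?orbT.
have p_size p : p \in marks b -> size (cleaves (C ++ p.1)) = n.+1.
  by move=> /marks_size; move: sCb; rewrite cleaves_cat size_cat; lia.
(* Here (z,y) is the new minimal letter: by antisymmetry it acts on its sibling [s], and the
   induction hypothesis applies with [s] for [b] and the outer siblings added to [C]. *)
have small p : p \in marks b -> lt (Node z p.2) h ->
    hall_bounded (ad C (ad p.1 (lie (ev i z) (ev i p.2)))) (weight n (sib p.1)).
  move=> pm gh; have [D [s pE]] := marks_sibling b_gt1 pm.
  have gmin x : x \in S -> lt (Node z p.2) x.
    move=> xS; have Bg := Bz _ (pS p pm).
    exact: (hall_lt_le_trans HB Bg (BS _ hS) (BS _ xS) gh (hmin _ xS)).
  have sE : {subset leaves s ++ cleaves (C ++ D) <= S}.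
    move=> x xs; apply: (pC p pm).
    by rewrite pE -rcons_cat cleaves_rcons mem_cat orbC -mem_cat.
  have [Ds bs] := marks_left_le HB Bb pm pE.
  have Bp := marks_hall HB Bb pm.
  rewrite pE sib_rcons ad_rcons lieC !adN; apply/hall_boundedN; rewrite -ad_cat.
  apply: (IHn _ _ (Node z p.2)).
  - by have := p_size p pm; rewrite pE -rcons_cat cleaves_rcons size_cat size_leaves.
  - apply: alphabetic_sub (az _ (pS p pm)) => x.
    by rewrite !inE => /orP[->//|/sE->]; rewrite orbT.
  - by move=> x /sE; apply: gmin.
  - by apply: Bp; rewrite pE mem_rcons mem_head.
  - move=> c; rewrite mem_cat => /orP[/BC//|cD]; apply: Bp.
    by rewrite pE mem_rcons inE cD orbT.
  - move=> c; rewrite mem_cat => /orP[cC|/Ds//].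
    have : B (flat s) by apply: Bp; rewrite pE mem_rcons mem_head.
    move: (b) bs bC Bb b_gt1 => [//|b1 b2] bs bC' Bb' _ Bs.
    have [Bb1 _ _ _] := hall_flat HB Bb'.
    exact: (left_le_trans HB Bs Bb1 (BC _ cC) bs (bC' _ cC)).
have sum_le : \sum_(p <- marks b) weight n (sib p.1)
    <= weight n 1 + \sum_(1 <= k < br_size b) weight n k.
  by apply: sum_sib => //; apply: weight_homo.
have bound p : p \in marks b -> spared B h (C ++ p.1) ->
    hall_bounded (ad C (ad p.1 (lie (ev i z) (ev i p.2)))) (weight n (sib p.1)).
  move=> pm sp; have pSm := pS p pm.
  have [hg|gh] := hall_le_or_lt HB (BS _ hS) (Bz _ pSm); last exact: small.
  apply: hall_bounded_leq (weight_ge_fact n _) _; rewrite -ad_cat.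
  apply: (@spared_bound n (C ++ p.1) (Node z p.2) h S) => //.
  - exact: az.
  - exact: pC.
  - exact: p_size.
have bS : {subset leaves b <= S} by move=> x xb; rewrite mem_cat xb.
have [hb|hb] := boolP (h \in leaves b).
  have [_ [m1 [p0 [m2 [mE s0 mP]]]]] := min_merges HB aS bS hmin Bb hb b_gt1.
  (* The mark [p0] is granted (n+1)! terms without a merge. In [sum_le] its sibling of size 1
     accounts for the extra [weight n 1], so the other marks fit into the sum in [weight]. *)
  pose f p := if p \in m1 ++ m2 then weight n (sib p.1) else n.+1`!.
  apply: (@hall_bounded_leq (\sum_(p <- marks b) f p)); last first.
    apply: hall_bounded_marks => p pm; rewrite /f; case: ifP => [pm12|_].
      apply: bound => //; case: (mP p pm12) => [[C' m]|[D ->]].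
        by left; exists (C ++ C'); apply: cmerges_catr.
      by right; exists (C ++ D); rewrite rcons_cat.
    rewrite -ad_cat; apply: (@plug_bound n.+1 (C ++ p.1) (Node z p.2)).
      exact: p_size.
    apply: alphabetic_sub (az _ (pS p pm)) => x.
    by rewrite !inE => /orP[->//|/(pC p pm)->]; rewrite orbT.
  have f0 : f p0 <= n.+1`!.
    rewrite /f; case: ifP => // _; rewrite s0 weight1 factS; exact: leq_pmull.
  have f12 : \sum_(p <- m1 ++ m2) f p = \sum_(p <- m1 ++ m2) weight n (sib p.1).
    by apply: eq_big_seq => p pm; rewrite /f pm.
  move: sum_le f12; rewrite mE !big_cat /= !big_cons /= s0 => sum_le f12.
  by move: f12 f0 sum_le; lia.
have [c cC hc] : exists2 c, c \in C & h \in leaves c.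
  move: hS; rewrite mem_cat (negbTE hb) /= => /flattenP[_ /mapP[c cC ->] hc].
  by exists c.
have cS : {subset leaves c <= S}.
  move=> x xc; rewrite mem_cat; apply/orP; right; apply/flattenP.
  by exists (leaves c) => //; apply: map_f.
(* If [c] were the letter h, the left factor of [b] would be at most h, which would force h into
   [b]. *)
have c_gt1 : 1 < br_size c.
  have [[x cE]|//] := leaf_or_size_gt1 c; have := bC _ cC.
  move: hc; rewrite cE inE => /eqP <-.
  move: (b) b_gt1 Bb bS hb => [//|b1 b2] _ Bb' bS' hb' b1h.
  have [Bb1 _ _ _] := hall_flat HB Bb'.
  have b1S : {subset leaves b1 <= S} by move=> y yb; rewrite bS' // mem_cat yb.
  by move: hb'; rewrite mem_cat (min_in_leaves HB BS b1S hS hmin Bb1 b1h).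
have [[c' mc] _] := min_merges HB aS cS hmin (BC _ cC) hc c_gt1.
have spC p : spared B h (C ++ p).
  left; case/splitPr: cC => C1 C2; rewrite -catA /=.
  by exists (C1 ++ c' :: C2 ++ p); exists C1, c, c', (C2 ++ p).
apply: (@hall_bounded_leq (\sum_(p <- marks b) weight n (sib p.1))); last first.
  apply: (hall_bounded_marks (f := fun p => weight n (sib p.1))) => p pm.
  exact: bound.
(* No leaf is exceptional here, and the extra [weight n 1] is n!, at most (n+1)!. *)
apply: leq_trans sum_le _; rewrite /= leq_add2r weight1 factS; exact: leq_pmull.
Qed.

(* Read b as a bracket of the letters available once everything below a has
   been eliminated. *)
Lemma folding a b : B a -> B b -> lt a b ->
  exists t, [/\ flat t = b, br_size t <= br_size b &
    forall x, x \in leaves t -> [/\ B x, lt a x & left_le lt x a]].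
Proof.
move=> Ba; elim: b => [y|b1 IH1 b2 IH2] Bb ab.
  by exists (Leaf (Leaf y)); split=> // x; rewrite inE => /eqP ->.
have [B1 B2 lt12 _] := (hall_nodeP HB b1 b2).1 Bb.
have [b1a|ab1] := hall_le_or_lt HB B1 Ba.
  exists (Leaf (Node b1 b2)); split=> [//||x]; last by rewrite inE => /eqP ->.
  by rewrite /= addn_gt0 br_size_gt0.
have [t1 [E1 s1 l1]] := IH1 B1 ab1.
have [t2 [E2 s2 l2]] := IH2 B2 (hall_trans HB Ba B1 B2 ab1 lt12).
exists (Node t1 t2); split=> /=; rewrite ?E1 ?E2 ?leq_add // => x.
by rewrite mem_cat => /orP[/l1|/l2].
Qed.

Lemma hall_bracket_bound a b : B a -> B b -> lt a b ->
  hall_bounded (lie (ev i a) (ev i b)) (weight (br_size b).-1 (br_size b)).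
Proof.
move=> Ba Bb ab; have [t [tE st tP]] := folding Ba Bb ab; subst b.
have tS x : x \in leaves t ++ cleaves [::] -> [/\ B x, lt a x & left_le lt x a].
  by rewrite cats0; apply: tP.
have t0 := br_size_gt0 t; have b0 := br_size_gt0 (flat t).
(* Folding can only lower the number of letters, and the diagonal weights are nondecreasing. *)
apply: (@hall_bounded_leq (weight (br_size t).-1 (br_size t))).
  have := @weight_diag_homo (br_size t).-1 (br_size (flat t)).-1.
  by rewrite !prednK //; apply; lia.
apply: (@derivation_bound _ [::] t a); rewrite ?prednK //.
- have aS x : x \in a :: leaves t ++ cleaves [::] -> B x.
    by rewrite inE => /orP[/eqP->|/tS[]].
  split=> // x y; rewrite !inE => /orP[/eqP->|xS] /orP[/eqP->|yS].
  + exact: (left_le_refl HB).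
  + have [By ay _] := tS y yS.
    by apply: (left_le_trans HB Ba Ba By (left_le_refl HB Ba)); right.
  + by have [] := tS x xS.
  + have [Bx _ xa] := tS x xS; have [By ay _] := tS y yS.
    by apply: (left_le_trans HB Bx Ba By xa); right.
- by move=> x /tS[].
Qed.

(** * From signed sums to the norm *)

Local Open Scope ring_scope.

(** Terms with the same Hall tree are collected; each sign adds at most 1 to the sum of absolute
    values. *)
Lemma hall_bounded_coef (s : seq (br X)) (p : seq (bool * br X)) : uniq s ->
  (forall q, q \in p -> q.2 \in s) ->
  exists alpha : br X -> K, [/\ forall c, c \notin s -> alpha c = 0,
    \sum_(c <- s) alpha c *: ev i c = \sum_(q <- p) (-1) ^+ q.1 *: ev i q.2 :> L
    & \sum_(c <- s) `|alpha c| <= (size p)%:R].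
Proof.
move=> us; elim: p => [|[b t] p IHp] ps.
  exists (fun=> 0); split=> //; rewrite ?big_nil big1 // => c _.
    by rewrite scale0r.
  by rewrite normr0.
have [|alpha [a0 aE an]] := IHp; first by move=> q qp; apply: ps; rewrite inE qp orbT.
have ts : t \in s by apply: (ps (b, t)); rewrite mem_head.
pose delta c : K := if c == t then (-1) ^+ b else 0.
exists (fun c => delta c + alpha c); split.
- move=> c cs; rewrite a0 // /delta addr0; case: eqP => // ct.
  by rewrite ct ts in cs.
- under eq_bigr => c _ do rewrite scalerDl.
  rewrite big_split /= aE big_cons; congr (_ + _).
  rewrite (bigD1_seq t) //= /delta eqxx big1 ?addr0 // => c /negbTE ->.
  by rewrite scale0r.
apply: (@le_trans _ _ (\sum_(c <- s) (`|delta c| + `|alpha c|))).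
  by apply: ler_sum => c _; apply: ler_normD.
rewrite big_split /= -add1n natrD; apply: lerD => //.
rewrite (bigD1_seq t) //= /delta eqxx normr_sign big1 ?addr0 // => c /negbTE ->.
by rewrite normr0.
Qed.

Lemma fsbig_cover (M : nmodType) (s : seq (br X)) (F : br X -> M) : uniq s ->
  (forall c, c \in s -> B c) -> (forall c, B c -> c \notin s -> F c = 0) ->
  \sum_(c \in B) F c = \sum_(c <- s) F c.
Proof.
move=> us sB F0; rewrite [RHS]fsbig_seq //; symmetry.
apply: fsbig_widen => c /=; first exact: sB.
by case=> Bc /negP cs; apply: F0.
Qed.

Hypothesis free : is_free_lie_algebra i.

Lemma hall_expansion_unique u (alpha beta : br X -> K) :
  hall_expansion i B u alpha -> hall_expansion i B u beta -> alpha = beta.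
Proof.
move=> [fina a0 ua] [finb b0 ub].
have [s1 E1] := (finite_seqP _).1 fina; have [s2 E2] := (finite_seqP _).1 finb.
pose s := [seq c <- undup (s1 ++ s2) | `[< B c >]].
have us : uniq s by rewrite filter_uniq ?undup_uniq.
have sB c : c \in s -> B c by rewrite mem_filter => /andP[/asboolP].
have sup c : (alpha c != 0) || (beta c != 0) -> c \in s.
  move=> ab; rewrite mem_filter mem_undup mem_cat; apply/andP; split.
    apply/asboolP/not_notP => nB; move: ab.
    by rewrite a0 ?b0 ?eqxx.
  case/orP: ab => ab; apply/orP; [left|right].
    by have : [set c | alpha c != 0]%classic c by []; rewrite E1.
  by have : [set c | beta c != 0]%classic c by []; rewrite E2.
have cover (gamma : br X -> K) : (forall c, gamma c != 0 -> c \in s) ->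
    \sum_(c \in B) gamma c *: ev i c = \sum_(c <- s) gamma c *: ev i c :> L.
  move=> gs; apply: fsbig_cover => // c _ cs.
  have [->|/gs] := eqVneq (gamma c) 0; first by rewrite scale0r.
  by rewrite (negbTE cs).
rewrite cover in ua; last by move=> c ac; apply: sup; rewrite ac.
rewrite cover in ub; last by move=> c bc; apply: sup; rewrite bc orbT.
have diff0 c : c \in s -> alpha c - beta c = 0.
  apply: (hall_independent HB free us sB (alpha := fun c => alpha c - beta c)).
  under eq_bigr => d _ do rewrite scalerBl.
  by rewrite sumrB -ua -ub subrr.
apply: funext => c; have [cs|cs] := boolP (c \in s).
  by apply/eqP; rewrite -subr_eq0 diff0.
have := contraNN (sup c) cs; rewrite negb_or !negbK => /andP[/eqP-> /eqP->].
by [].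
Qed.

Lemma hall_norm_bounded u n : hall_bounded u n -> hall_norm i B u <= n%:R.
Proof.
move=> [p [pB pn uE]]; pose s := undup [seq q.2 | q <- p].
have us : uniq s by apply: undup_uniq.
have ps q : q \in p -> q.2 \in s by move=> qp; rewrite mem_undup map_f.
have sB c : c \in s -> B c by rewrite mem_undup => /mapP[q /pB ? ->].
have [alpha [a0 aE an]] := hall_bounded_coef us ps.
have exp_alpha : hall_expansion i B u alpha.
  split.
  - apply: (@sub_finite_set _ _ [set` s]%classic); last exact: finite_seq.
    by move=> c /= ac; apply: contraNT ac => /a0 ->.
  - by move=> c nB; apply: a0; apply/negP => /sB.
  - by rewrite (@fsbig_cover _ s) ?aE // => c _ /a0 ->; rewrite scale0r.
(* Uniqueness of the expansion makes [xget] return [alpha]. *)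
rewrite /hall_norm /hall_coord (@xget_subset1 _ _ _ alpha) //; last first.
  by move=> x y /= xe ye; apply: hall_expansion_unique xe ye.
rewrite (@fsbig_cover _ s) // => [|c _ /a0 ->]; last by rewrite normr0.
by apply: le_trans an _; rewrite ler_nat.
Qed.

End LieBounds.

Theorem theorem1p3 (R : realType) (k : scalars) (X : Type)
    (L : lieAlgType (scalar_field R k)) (i : X -> L)
    (B : set (br X)) (lt : rel (br X)) (a b : br X) :
  (exists x y : X, x <> y) ->
  is_free_lie_algebra i ->
  hall_set B lt ->
  B a -> B b -> lt a b ->
  hall_norm i B (lie (ev i a) (ev i b))
    <= (Num.floor (expR 1 * ((br_size b).-1)`!%:R : R))%:~R.
Proof.
move=> _ free HB Ba Bb ab.
apply: le_trans (hall_norm_bounded HB free (hall_bracket_bound i HB Ba Bb ab)) _.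
(* Both sides are integers, so the comparison moves from the scalar field to the integers and then,
   past the floor, to [R]. *)
rewrite pmulrn ler_int floor_ge_int -pmulrn.
by have := weight_diag_expR R (br_size b).-1; rewrite prednK ?br_size_gt0.
Qed.
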